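(* Let $\mathcal G$ be a directed graph with vertex set $\{1,\dots,n\}$ and $m$ edges (self-loops included), and assume that $\mathcal G$ is strongly connected and has a self-loop on each vertex. Let $\mathbb F_q$ be the finite field with $q$ elements. Let $A$ be an $n\times n$ matrix over $\mathbb F_q$ consistent with $\mathcal G$ (i.e., $A_{uv}=0$ if $(v,u)$ is not an edge of $\mathcal G$), and let the $m$ entries of $A$ corresponding to the edges of $\mathcal G$ be parameters $\lambda_1,\dots,\lambda_m$. Let the initial state be $\boldsymbol x(0)=(\xi_1,\dots,\xi_n)^T$ for parameters $\xi_1,\dots,\xi_n$. Let $\lambda_1,\dots,\lambda_m,\xi_1,\dots,\xi_n$ be independent random variables, each uniformly distributed over $\mathbb F_q$. If $q\ge n^2$, then for any given $r\in\{1,\dots,n\}$, $$\Pr\big(\operatorname{rank} H^{(r)}_n=n\big)\ \ge\ 1-\frac{n^2}{q}.$$ Moreover, defining $d=\frac{n^3+n}{2}$, if $q\ge d$, then $$\Pr\big(\operatorname{rank} H^{(r)}_n=n\ \text{ for all } r=1,\dots,n\big)\ \ge\ 1-\frac{d}{q}.$$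
   Context: An edge $(v,u)$ is directed from $v$ to $u$. A directed graph is strongly connected if for every pair of vertices $u,v$ there is a directed path from $u$ to $v$. Consider the discrete-time linear system $\boldsymbol x(k+1)=A\boldsymbol x(k)$, $k=0,1,2,\dots$, over $\mathbb F_q$ (all operations performed in $\mathbb F_q$), with initial state $\boldsymbol x(0)$. For $r\in\{1,\dots,n\}$ let $\boldsymbol e_r$ be the column vector with $1$ in position $r$ and $0$ elsewhere, and let $y^{(r)}(k)=\boldsymbol e_r^T\boldsymbol x(k)=\boldsymbol e_r^TA^k\boldsymbol x(0)\in\mathbb F_q$. For a positive integer $j$, the Hankel matrix $H^{(r)}_j$ is the $j\times j$ matrix over $\mathbb F_q$ whose entry in row $a$ and column $b$ ($1\le a,b\le j$) is $y^{(r)}(a+b-2)$; its rank is taken over $\mathbb F_q$. *)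

(* Defs.v *)
From HB Require Import structures.
From mathcomp Require Import all_boot all_order all_algebra.
From mathcomp Require Import all_classical all_reals all_analysis.

Set Implicit Arguments.
Unset Strict Implicit.
Unset Printing Implicit Defensive.

Import Order.TTheory GRing.Theory Num.Theory.

Local Open Scope classical_set_scope.
Local Open Scope ring_scope.

(* A copy of F that carries the discrete sigma-algebra, so that random variables
   with values in F can be written {RV P >-> discrete F}. *)
Definition discrete (F : finFieldType) : Type := F.

HB.instance Definition _ (F : finFieldType) := Choice.on (discrete F).
HB.instance Definition _ (F : finFieldType) :=
  isPointed.Build (discrete F) (0 : F).
HB.instance Definition _ (F : finFieldType) :=
  @isMeasurable.Build default_measure_display (discrete F)
    discrete_measurable discrete_measurable0
    discrete_measurableC discrete_measurableU.

Definition uniform_rv (d : measure_display) (T : measurableType d)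
    (R : realType) (P : probability T R) (F : finFieldType)
    (X : {RV P >-> discrete F}) : Prop :=
  forall a : F, P (X @^-1` [set a]) = (#|F|%:R^-1)%:E.

(* The family is indexed by a finite type, so every subfamily is given by
   some J : {set I}. *)
Definition mutually_independent (d d' : measure_display)
    (T : measurableType d) (T' : measurableType d') (R : realType)
    (P : probability T R) (I : finType) (X : I -> {RV P >-> T'}) : Prop :=
  forall (J : {set I}) (B : I -> set T'),
    (forall i, i \in J -> measurable (B i)) ->
    P (\bigcap_(i in [set` J]) (X i @^-1` B i)) =
      (\prod_(i in J) P (X i @^-1` B i))%E.

(* A directed graph on {1, ..., n} is a relation g on 'I_n (vertex i is the
   ordinal i - 1), where g v u means that (v, u) is an edge, directed from v
   to u. *)
Definition strongly_connected (n : nat) (g : rel 'I_n) : Prop :=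
  forall u v : 'I_n, connect g u v.

Notation edge g := {e | g e.1 e.2}.

Definition consistent (F : finFieldType) (n : nat) (g : rel 'I_n)
    (A : 'M[F]_n) : Prop :=
  forall u v : 'I_n, ~~ g v u -> A u v = 0.

Definition sum_family (I J V : Type) (f : I -> V) (h : J -> V) (k : I + J) : V :=
  match k with inl i => f i | inr j => h j end.

Section LinearSystem.
Variables (F : finFieldType) (n : nat) (A : 'M[F]_n) (x0 : 'cV[F]_n).

Definition state (k : nat) : 'cV[F]_n := iter k (mulmx A) x0.

Definition output (r : 'I_n) (k : nat) : F :=
  ((delta_mx r 0 : 'cV[F]_n)^T *m state k) 0 0.

(* With rows and columns numbered from 0, the index (a + 1) + (b + 1) - 2 of
   the output becomes a + b. *)
Definition hankel (r : 'I_n) (j : nat) : 'M[F]_j :=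
  \matrix_(a < j, b < j) output r (a + b).

End LinearSystem.

(* Main.v *)
Require Import Defs.
From mathcomp Require Import all_boot all_order all_algebra.
From mathcomp Require Import all_classical all_reals all_analysis.
From mathcomp Require Import zify.

(* The Hankel matrix factors as O_r C, where C = [x0, A x0, ..., A^(n-1) x0] and
   the rows of O_r are e_r^T A^i.  As functions of the parameters, det O_r and
   det C are homogeneous of degree k = n(n-1)/2 and k = n(n-1)/2 + n, and the
   stated bounds are the union bound over these determinants.  For f homogeneous
   of degree k with f(w) <> 0, the polynomial f(x + t w) in t has leading term
   f(w) t^k, so each line parallel to w has at most k zeros of f, and f vanishes
   on a fraction at most k / q of the parameter space.  For det C a nonvanishing
   w is a diagonal matrix with distinct entries together with x0 = (1, ..., 1);
   for det O_r it is such a diagonal matrix plus a spanning in-tree towards r,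
   whose eigenvectors all have a nonzero r-th entry. *)

Set Implicit Arguments.
Unset Strict Implicit.
Unset Printing Implicit Defensive.

Import Order.TTheory GRing.Theory Num.Theory.

Local Open Scope ring_scope.

(** * Krylov matrices and a criterion for a nonzero determinant *)

(** The reachability matrix of [(A, x)]; applied to [A^T] and [e_r] it is the transpose of the
    observability matrix of output [r]. *)
Definition krylov (R : comNzRingType) (n : nat) (A : 'M[R]_n) (x : 'cV[R]_n) :
    'M[R]_n :=
  \matrix_(i, j) iter j (mulmx A) x i 0.

Lemma map_krylov (R S : comNzRingType) (f : {rmorphism R -> S}) (n : nat)
    (A : 'M[R]_n) (x : 'cV[R]_n) :
  map_mx f (krylov A x) = krylov (map_mx f A) (map_mx f x).
Proof.
have E k : map_mx f (iter k (mulmx A) x) =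
    iter k (mulmx (map_mx f A)) (map_mx f x).
  by elim: k => //= k IH; rewrite map_mxM IH.
by apply/matrixP => i j; rewrite !mxE -E mxE.
Qed.

(* Multiplying [krylov A x] on the left by the matrix of the [s j] gives a
   Vandermonde matrix with rows scaled by [s j *m x]. *)
Lemma krylov_det_neq0 (F : fieldType) (n : nat) (A : 'M[F]_n) (x : 'cV[F]_n)
    (d : 'I_n -> F) (s : 'I_n -> 'rV[F]_n) :
  injective d -> (forall j, s j *m A = d j *: s j) ->
  (forall j, (s j *m x) 0 0 != 0) -> \det (krylov A x) != 0.
Proof.
move=> d_inj sA sx.
have pow j k : (s j *m iter k (mulmx A) x) 0 0 = (s j *m x) 0 0 * d j ^+ k.
  elim: k => [|k IH] /=; first by rewrite expr0 mulr1.
  by rewrite mulmxA sA -scalemxAl mxE IH exprS mulrCA.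
have SK : (\matrix_j s j) *m krylov A x =
    diag_mx (\row_j (s j *m x) 0 0) *m (Vandermonde n (\row_j d j))^T.
  apply/matrixP => i k; transitivity ((s i *m iter k (mulmx A) x) 0 0).
    by rewrite !mxE; apply: eq_bigr => l _; rewrite !mxE.
  rewrite pow mul_diag_mx mxE.
  by congr (_ * _); [rewrite [RHS]mxE | rewrite !mxE].
have: \det ((\matrix_j s j) *m krylov A x) != 0.
  rewrite SK det_mulmx det_tr det_diag det_Vandermonde mulf_neq0 //.
    by apply/prodf_neq0 => j _; rewrite mxE.
  apply/prodf_neq0 => i _; apply/prodf_neq0 => j lt_ij.
  by rewrite !mxE subr_eq0 (inj_eq d_inj) -(inj_eq val_inj) neq_ltn lt_ij orbT.
by rewrite det_mulmx mulf_eq0 negb_or => /andP[].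
Qed.

(* [c] may be zero: [k] only bounds the degree of [p]. *)
Definition formal_lead (F : fieldType) (k : nat) (c : F) (p : {poly F}) :
    Prop :=
  (size p <= k.+1)%N /\ p`_k = c.

(** * Leading coefficients along pencils [A + t W] *)

Section FormalLead.
Variable F : fieldType.
Implicit Types (p q : {poly F}) (a b c : F) (k l : nat).

Lemma formal_lead_sum (I : finType) k (c : I -> F) (p : I -> {poly F}) :
  (forall i, formal_lead k (c i) (p i)) ->
  formal_lead k (\sum_i c i) (\sum_i p i).
Proof.
move=> H; split.
  apply: (leq_trans (size_sum _ _ _)); apply/bigmax_leqP => i _.
  by have [] := H i.
by rewrite coef_sum; apply: eq_bigr => i _; have [] := H i.
Qed.

Lemma formal_leadM k l a b p q :
  formal_lead k a p -> formal_lead l b q -> formal_lead (k + l) (a * b) (p * q).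
Proof.
move=> [sp pk] [sq ql]; split.
  by apply: (leq_trans (size_polyMleq _ _)); lia.
rewrite coefM (bigD1 (inord k)) //= inordK ?ltnS ?leq_addr // addKn pk ql.
rewrite big1 ?addr0 // => i /eqP ne.
have {}ne : nat_of_ord i <> k.
  by move=> e; apply: ne; apply: val_inj; rewrite /= inordK ?ltnS ?leq_addr.
have [lt|le] := ltnP i k.
  by rewrite [q`__]nth_default ?mulr0 //; apply: leq_trans sq _; lia.
by rewrite nth_default ?mul0r //; apply: leq_trans sp _; lia.
Qed.

Lemma formal_leadCM k a c p :
  formal_lead k c p -> formal_lead k (a * c) (a%:P * p).
Proof.
by move=> H; rewrite -[k]add0n; apply: formal_leadM => //; split;
   rewrite ?coefC // size_polyC; case: eqP.
Qed.

Lemma formal_lead_linear a b : formal_lead 1 b (a%:P + 'X * b%:P).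
Proof.
rewrite mulrC addrC -cons_poly_def; split; last by rewrite coef_cons coefC.
by rewrite size_cons_poly; case: ifP => // _; rewrite size_polyC; case: eqP.
Qed.

Lemma formal_lead_prod n (k : 'I_n -> nat) (c : 'I_n -> F)
    (p : 'I_n -> {poly F}) :
  (forall i, formal_lead (k i) (c i) (p i)) ->
  formal_lead (\sum_i k i) (\prod_i c i) (\prod_i p i).
Proof.
elim: n k c p => [|n IH] k c p H.
  by rewrite !big_ord0; split; rewrite ?size_poly1 ?coef1.
by rewrite !big_ord_recl; apply: formal_leadM => //; apply: IH.
Qed.

(** Each Leibniz term takes one entry from every column, so a degree bound depending only on the
    column gives all terms the same total. *)
Lemma formal_lead_det n (k : 'I_n -> nat) (C : 'M[F]_n) (M : 'M[{poly F}]_n) :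
  (forall i j, formal_lead (k j) (C i j) (M i j)) ->
  formal_lead (\sum_j k j) (\det C) (\det M).
Proof.
(* Transposing indexes the Leibniz products by columns, where the degrees [k j] live. *)
move=> H; rewrite -[\det C]det_tr -[\det M]det_tr.
apply: formal_lead_sum => s.
have -> : (-1) ^+ perm.odd_perm s = ((-1) ^+ perm.odd_perm s)%:P :> {poly F}.
  by rewrite polyC_exp polyCN.
apply: formal_leadCM; apply: formal_lead_prod => i.
by rewrite !mxE.
Qed.

(** Each application of the pencil raises the degree by one, so column [j] has degree [j + m]. The
    initial vector has [m = 1] if it moves along the line too, [m = 0] if it is fixed. *)
Lemma formal_lead_krylov n m (A W : 'M[F]_n) (y : 'cV[F]_n)
    (x : 'cV[{poly F}]_n) :
  (forall i, formal_lead m (y i 0) (x i 0)) ->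
  formal_lead ('C(n, 2) + n * m) (\det (krylov W y))
    (\det (krylov (map_mx polyC A + 'X *: map_mx polyC W) x)).
Proof.
move=> Hx; set M := _ + _.
have -> : ('C(n, 2) + n * m = \sum_(j < n) (j + m))%N.
  by rewrite big_split /= sum_nat_const card_ord -bin2_sum big_mkord.
apply: formal_lead_det => i j; rewrite !mxE.
elim: (j : nat) i => [|k IH] i //=; rewrite !mxE.
apply: formal_lead_sum => l; rewrite addSn -add1n; apply: formal_leadM => //.
by rewrite !mxE; apply: formal_lead_linear.
Qed.

Lemma krylov_pencil n (A W : 'M[F]_n) (x y : 'cV[F]_n) :
  exists p, formal_lead ('C(n, 2) + n) (\det (krylov W y)) p /\
    forall t, p.[t] = \det (krylov (A + t *: W) (x + t *: y)).
Proof.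
exists (\det (krylov (map_mx polyC A + 'X *: map_mx polyC W)
          (map_mx polyC x + 'X *: map_mx polyC y))).
split.
  rewrite -[X in (_ + X)%N]muln1; apply: formal_lead_krylov => i.
  by rewrite !mxE; apply: formal_lead_linear.
move=> t; rewrite -horner_evalE -det_map_mx map_krylov.
congr (\det (krylov _ _));
  by apply/matrixP => i j; rewrite !mxE /= !horner_evalE !hornerE.
Qed.

Lemma krylov_pencil_cst n (A W : 'M[F]_n) (y : 'cV[F]_n) :
  exists p, formal_lead 'C(n, 2) (\det (krylov W y)) p /\
    forall t, p.[t] = \det (krylov (A + t *: W) y).
Proof.
exists (\det (krylov (map_mx polyC A + 'X *: map_mx polyC W) (map_mx polyC y))).
split.
  rewrite -['C(n, 2)]addn0 -[X in (_ + X)%N](muln0 n).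
  apply: formal_lead_krylov => i.
  by rewrite mxE; split; rewrite ?coefC // size_polyC; case: eqP.
move=> t; rewrite -horner_evalE -det_map_mx map_krylov.
congr (\det (krylov _ _));
  by apply/matrixP => i j; rewrite !mxE /= !horner_evalE !hornerE.
Qed.

End FormalLead.

(** * Counting zeros over a finite field *)

Lemma card_roots_le (F : finFieldType) k (c : F) (p : {poly F}) :
  formal_lead k c p -> c != 0 -> (#|[set t | root p t]| <= k)%N.
Proof.
move=> [sp pk] c0.
have p0 : p != 0 by apply: contraNneq c0 => p0; rewrite -pk p0 coef0.
rewrite -ltnS cardE; apply: leq_trans sp.
apply: max_poly_roots (enum_uniq _) => //.
by apply/allP => t; rewrite mem_enum inE.
Qed.

(* Averaging over the lines parallel to [w]. *)
Lemma card_zeros_le (F : finFieldType) (I : finType) k (c : F)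
    (f : {ffun I -> F} -> F) (w : {ffun I -> F}) : c != 0 ->
  (forall x : {ffun I -> F}, exists p, formal_lead k c p /\
     forall t, p.[t] = f [ffun i => x i + t * w i]) ->
  (#|F| * #|[set x | f x == 0%R]| <= k * #|{ffun I -> F}|)%N.
Proof.
move=> c0 Hp.
pose sh (t : F) (x : {ffun I -> F}) := [ffun i => x i + t * w i].
have cz t : #|[set x | f (sh t x) == 0%R]| = #|[set x | f x == 0%R]|.
  have sh_inj : injective (sh t).
    move=> x y /ffunP e; apply/ffunP => i.
    by have := e i; rewrite !ffunE; apply: addIr.
  have -> : [set x | f (sh t x) == 0%R] = sh t @^-1: [set x | f x == 0%R].
    by apply/setP => x; rewrite !inE.
  by rewrite on_card_preimset //; apply: onW_bij; apply: injF_bij.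
(* Both sides count pairs [(t, x)] with [f (x + t w) = 0]: by [cz] every [t] contributes equally,
   while for fixed [x] the root bound applies. *)
have -> : (#|F| * #|[set x | f x == 0%R]| =
    \sum_(x : {ffun I -> F}) #|[set t | f (sh t x) == 0%R]|)%N.
  rewrite -sum_nat_const -[RHS](eq_bigr _ (fun _ _ => sum1dep_card _)) /=.
  under [RHS]eq_bigr do rewrite big_mkcond.
  rewrite exchange_big /=; apply: eq_big => [//|t _].
  by rewrite -(cz t) -sum1dep_card big_mkcond.
rewrite mulnC -sum_nat_const; apply: leq_sum => x _.
have [p [lead_p pE]] := Hp x.
apply: leq_trans (card_roots_le lead_p c0).
by apply: subset_leq_card; apply/fintype.subsetP => t; rewrite !inE rootE pE.
Qed.

(** * Spanning in-trees and their matrices *)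

(** [h] is the distance to [r], and [p v] is the second vertex of a shortest path from [v] to
    [r]. *)
Lemma in_tree_exists (V : finType) (g : rel V) (r : V) :
  (forall v, connect g v r) ->
  exists (h : V -> nat) (p : V -> V),
    forall v, v != r -> g v (p v) /\ (h (p v) < h v)%N.
Proof.
move=> gr.
have ex v : exists k, [exists s : k.-tuple V, path g v s && (last v s == r)].
  have /connectP[s gs ->] := gr v.
  by exists (size s); apply/existsP; exists (in_tuple s); rewrite gs eqxx.
pose h v := ex_minn (ex v).
have hle v s : path g v s -> last v s = r -> (h v <= size s)%N.
  move=> gs ls; rewrite /h; case: ex_minnP => k _; apply.
  by apply/existsP; exists (in_tuple s); rewrite gs ls eqxx.
have step v : exists u, v != r -> g v u /\ (h u < h v)%N.
  have [s gs [ls <-]] : exists2 s, path g v s & last v s = r /\ size s = h v.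
    rewrite /h; case: ex_minnP => k /existsP[s /andP[gs /eqP ls]] _.
    by exists s; rewrite // size_tuple.
  case: s gs ls => [|u s] /= => [_ ->|/andP[gu gs] ls].
    by exists v; rewrite eqxx.
  by exists u => _; split=> //; rewrite ltnS; apply: hle.
by have [p pP] := fin_all_exists step; exists h, p.
Qed.

Section TreeMatrix.
Variables (F : fieldType) (n : nat) (r : 'I_n) (d : 'I_n -> F).
Variable p : 'I_n -> 'I_n.

(** The tree edge from [v] to [p v] sits in row [p v], column [v], as [consistent] requires. *)
Definition tree_mx : 'M[F]_n :=
  \matrix_(u, v) (d u *+ (u == v) + ((v != r) && (u == p v))%:R).

Lemma tree_mx_delta v :
  tree_mx *m delta_mx v 0 =
  d v *: delta_mx v 0 + delta_mx (p v) 0 *+ (v != r) :> 'cV_n.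
Proof.
apply/matrixP => u j; rewrite -colE !mxE mulmxnE !mxE ord1 eqxx !andbT.
congr (_ + _); last by case: (v != r); case: eqP.
by case: eqP => [->|_]; rewrite ?mulr1 ?mulr0.
Qed.

Variable h : 'I_n -> nat.
Hypothesis h_lt : forall v, v != r -> (h (p v) < h v)%N.

(** Since [tree_mx - a] sends [e_v] to [(d v - a) e_v + e_(p v)], a solution for [p v] yields one
    for [v], and its [r]-th entry only changes by a nonzero factor. The recursion ends at [r]; the
    bound on [h] covers all vertices met on the way. *)
Lemma tree_mx_resolvent (a : F) v :
  (forall u, (h u <= h v)%N -> d u != a) ->
  exists t : 'cV_n, (tree_mx - a%:M) *m t = delta_mx v 0 /\ t r 0 != 0.
Proof.
have [k hv] := ubnP (h v); elim: k v hv => // k IH v; rewrite ltnS => hv da.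
have dv : d v - a != 0 by rewrite subr_eq0 da.
have [vr|vr] := eqVneq v r.
  exists ((d v - a)^-1 *: delta_mx v 0); split.
    rewrite -scalemxAr mulmxBl tree_mx_delta mul_scalar_mx vr eqxx addr0.
    by rewrite -scalerBl scalerA mulVf ?scale1r -?vr.
  by rewrite !mxE vr !eqxx mulr1 invr_neq0 // -vr.
have [||t [At tr]] := IH (p v); first exact: leq_trans (h_lt vr) hv.
  by move=> u hu; apply: da; apply: leq_trans hu (ltnW (h_lt vr)).
exists ((d v - a)^-1 *: (delta_mx v 0 - t)); split.
  rewrite -scalemxAr mulmxBr At mulmxBl tree_mx_delta vr mul_scalar_mx.
  by rewrite addrAC addrK -scalerBl scalerA mulVf ?scale1r.
by rewrite !mxE [r == v]eq_sym (negbTE vr) add0r mulf_neq0 ?invr_neq0 ?oppr_eq0.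
Qed.

Lemma tree_mx_eigenvector (d_inj : injective d) j :
  exists s : 'cV_n, tree_mx *m s = d j *: s /\ s r 0 != 0.
Proof.
have [->|jr] := eqVneq j r.
  exists (delta_mx r 0); rewrite tree_mx_delta eqxx addr0 mxE !eqxx.
  by split; rewrite ?oner_eq0.
(* Vertices no higher than [p j] exclude [j], so [d j] is not among their values; subtracting the
   resulting [t] from [e_j] cancels [e_(p j)]. *)
have [|t [At tr]] := @tree_mx_resolvent (d j) (p j).
  move=> u hu; rewrite (inj_eq d_inj); apply: contraTneq hu => ->.
  by rewrite -ltnNge h_lt.
exists (delta_mx j 0 - t); split.
  apply/eqP; rewrite -subr_eq0 -mul_scalar_mx -mulmxBl mulmxBr At mulmxBl.
  by rewrite tree_mx_delta jr mul_scalar_mx addrAC addrK subrr.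
by rewrite !mxE [r == j]eq_sym (negbTE jr) add0r oppr_eq0.
Qed.

End TreeMatrix.

(** * Parameter values with nonzero determinants *)

Lemma observable_witness (F : finFieldType) (n : nat) (g : rel 'I_n)
    (r : 'I_n) :
  (forall v, connect g v r) -> (forall v, g v v) -> (n <= #|F|)%N ->
  exists W : 'M[F]_n, consistent g W /\
    \det (krylov W^T (delta_mx r 0)) != 0.
Proof.
move=> gr gl nF; have [h [p hp]] := in_tree_exists gr.
(* [n <= #|F|] supplies [n] distinct eigenvalues. *)
pose d (i : 'I_n) : F := enum_val (widen_ord nF i).
have d_inj : injective d.
  by move=> i j /enum_val_inj /(congr1 val) /= e; apply: val_inj.
exists (tree_mx r d p); split.
  move=> u v ngvu; rewrite mxE; case: eqVneq ngvu => [->|uv ngvu].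
    by rewrite gl.
  rewrite mulr0n add0r; case: eqVneq => //= vr; case: eqP => // e.
  by rewrite e (proj1 (hp v vr)) in ngvu.
have ev := tree_mx_eigenvector (fun v vr => (hp v vr).2) d_inj.
have /fin_all_exists[s sP] : forall j, exists s : 'cV_n, _ := ev.
(* Transposed eigenvectors of [W] are left eigenvectors of [W^T], and pairing them with [e_r] reads
   off the [r]-th entry. *)
apply: (krylov_det_neq0 (d := d) (s := fun j => (s j)^T)) => // j.
  by rewrite -trmx_mul (sP j).1 linearZ.
by rewrite -colE !mxE (sP j).2.
Qed.

Lemma reachable_witness (F : finFieldType) (n : nat) : (n <= #|F|)%N ->
  exists W : 'M[F]_n, is_diag_mx W /\ \det (krylov W (const_mx 1)) != 0.
Proof.
move=> nF.
pose d (i : 'I_n) : F := enum_val (widen_ord nF i).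
have d_inj : injective d.
  by move=> i j /enum_val_inj /(congr1 val) /= e; apply: val_inj.
exists (diag_mx (\row_j d j)); split; first exact: diag_mx_is_diag.
apply: (krylov_det_neq0 (d := d) (s := fun j => delta_mx 0 j)) => // j.
  by rewrite -rowE row_diag_mx mxE.
by rewrite -rowE !mxE oner_eq0.
Qed.

(** * Factorization of the Hankel matrix *)

Lemma hankelE (F : finFieldType) (n : nat) (A : 'M[F]_n) (x : 'cV[F]_n) r :
  hankel A x r n = (krylov A^T (delta_mx r 0))^T *m krylov A x.
Proof.
have it k z : (iter k (mulmx A^T) (delta_mx r 0))^T *m z =
    (delta_mx r 0)^T *m iter k (mulmx A) z.
  elim: k z => //= k IH z.
  by rewrite trmx_mul trmxK -mulmxA IH -iterSr.
apply/matrixP => a b; rewrite mxE /output /state iterD -{}it.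
by rewrite !mxE; apply: eq_bigr => l _; rewrite !mxE.
Qed.

Lemma hankel_rank (F : finFieldType) (n : nat) (A : 'M[F]_n) (x : 'cV[F]_n) r :
  (\rank (hankel A x r n) == n) =
  (\det (krylov A^T (delta_mx r 0)) != 0) && (\det (krylov A x) != 0).
Proof.
rewrite -[_ == n]/(row_free _) row_free_unit unitmxE unitfE hankelE.
by rewrite det_mulmx det_tr mulf_eq0 negb_or.
Qed.

(** * Counting bad points of the parameter space *)

Section ParamSpace.
Variables (F : finFieldType) (n : nat) (g : rel 'I_n).
Local Notation V := {ffun (edge g + 'I_n)%type -> F}.

Definition param_mx (x : V) : 'M[F]_n :=
  \matrix_(u, v) if insub (v, u) is Some e then x (inl e) else 0.

Definition param_cv (x : V) : 'cV[F]_n := \col_i x (inr i).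

Definition param_of (A : 'M[F]_n) (y : 'cV[F]_n) : V :=
  [ffun k => match k with
             | inl e => A (val e).2 (val e).1
             | inr i => y i 0
             end].

Lemma param_ofK A y : consistent g A ->
  param_mx (param_of A y) = A /\ param_cv (param_of A y) = y.
Proof.
move=> gA; split; last by apply/colP => i; rewrite !mxE !ffunE.
apply/matrixP => u v; rewrite !mxE.
by case: insubP => [e _ ve|/= /gA //]; rewrite !ffunE ve.
Qed.

Lemma param_line (x w : V) (t : F) :
  let z : V := [ffun k => x k + t * w k] in
  param_mx z = param_mx x + t *: param_mx w /\
  param_cv z = param_cv x + t *: param_cv w.
Proof.
split; last by apply/colP => i; rewrite !mxE !ffunE.
apply/matrixP => u v; rewrite !mxE.
by case: insubP => [e _ _|_]; rewrite ?ffunE ?mulr0 ?addr0.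
Qed.

Hypothesis gl : forall v, g v v.
Hypothesis nF : (n <= #|F|)%N.

Lemma card_unreachable_le :
  (#|F| * #|[set x : V | \det (krylov (param_mx x) (param_cv x)) == 0%R]| <=
     ('C(n, 2) + n) * #|{: V}|)%N.
Proof.
have [W [/is_diag_mxP Wdiag detW]] := reachable_witness nF.
have [Wmx Wcv] : param_mx (param_of W (const_mx 1)) = W /\
    param_cv (param_of W (const_mx 1)) = const_mx 1.
  (* Self-loops make every diagonal matrix consistent with [g]. *)
  apply: param_ofK => u v ngvu; apply: Wdiag.
  by apply: contraNneq ngvu => uv; rewrite (val_inj uv) gl.
apply: (@card_zeros_le F _ _ _
  (fun x => \det (krylov (param_mx x) (param_cv x)))
  (param_of W (const_mx 1)) detW) => x.
have [p [lead_p pE]] := krylov_pencil (param_mx x) W (param_cv x) (const_mx 1).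
exists p; split=> // t; rewrite pE.
by have [-> ->] := param_line x (param_of W (const_mx 1)) t; rewrite Wmx Wcv.
Qed.

Lemma card_unobservable_le r : (forall v, connect g v r) ->
  (#|F| *
     #|[set x : V | \det (krylov (param_mx x)^T (delta_mx r 0%R)) == 0%R]| <=
     'C(n, 2) * #|{: V}|)%N.
Proof.
move=> gr; have [W [gW detW]] := observable_witness gr gl nF.
have [Wmx _] := param_ofK 0 gW.
apply: (@card_zeros_le F _ _ _
  (fun x => \det (krylov (param_mx x)^T (delta_mx r 0)))
  (param_of W 0) detW) => x.
have [p [lead_p pE]] := krylov_pencil_cst (param_mx x)^T W^T (delta_mx r 0).
exists p; split=> // t; rewrite pE.
by have [-> _] := param_line x (param_of W 0) t; rewrite Wmx linearD linearZ.
Qed.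

(** The reachability determinant is common to all [r] and is counted once; each [r] in [Q] adds one
    observability determinant. *)
Lemma card_rank_deficient_le (Q : {set 'I_n}) : strongly_connected g ->
  (#|F| * #|[set x : V | ~~ [forall r in Q,
       \rank (hankel (param_mx x) (param_cv x) r n) == n]]| <=
     ('C(n, 2) + n + #|Q| * 'C(n, 2)) * #|{: V}|)%N.
Proof.
move=> gc.
set C := [set x : V | \det (krylov (param_mx x) (param_cv x)) == 0%R].
pose O r := [set x : V | \det (krylov (param_mx x)^T (delta_mx r 0%R)) == 0%R].
have sub : [set x : V | ~~ [forall r in Q,
    \rank (hankel (param_mx x) (param_cv x) r n) == n]]
    \subset C :|: \bigcup_(r in Q) O r.
  apply/fintype.subsetP => x; rewrite !inE negb_forall_in => /exists_inP[r rQ].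
  rewrite hankel_rank negb_and !negbK => /orP[Ox|->//].
  by apply/orP; right; apply/bigcupP; exists r; rewrite ?inE.
apply: leq_trans (leq_mul (leqnn _) (subset_leq_card sub)) _.
apply: leq_trans (leq_mul (leqnn _) (leq_card_setU _ _)) _.
rewrite mulnDr mulnDl leq_add ?card_unreachable_le //.
have cardU : (#|\bigcup_(r in Q) O r| <= \sum_(r in Q) #|O r|)%N.
  apply: (big_ind2 (fun (S : {set V}) m => #|S| <= m)%N); rewrite ?cards0 //.
  move=> S1 m1 S2 m2 S1m S2m.
  exact: leq_trans (leq_card_setU _ _) (leq_add S1m S2m).
apply: leq_trans (leq_mul (leqnn _) cardU) _.
rewrite big_distrr /= -mulnA -sum_nat_const; apply: leq_sum => r _.
exact: card_unobservable_le.
Qed.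

End ParamSpace.

Local Open Scope classical_set_scope.
Local Open Scope ring_scope.

(** * The joint law of independent uniform parameters *)

Section JointLaw.
Variables (d : measure_display) (T : measurableType d) (R : realType)
  (P : probability T R) (F : finFieldType) (I : finType)
  (X : I -> {RV P >-> discrete F}).
Hypothesis X_indep : mutually_independent X.
Hypothesis X_uniform : forall i, uniform_rv (X i).

Definition joint (w : T) : {ffun I -> F} := [ffun i => X i w].

Lemma joint_fiberE (a : {ffun I -> F}) :
  joint @^-1` [set a] =
  \bigcap_(i in [set` [set: I]%SET]) (X i @^-1` [set (a i : discrete F)]).
Proof.
apply/seteqP; split=> w /=.
  by move=> <- i _ /=; rewrite ffunE.
by move=> H; apply/ffunP => i; rewrite ffunE; apply: H; rewrite /= inE.
Qed.

Lemma measurable_joint_fiber a : measurable (joint @^-1` [set a]).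
Proof.
rewrite joint_fiberE; apply: fin_bigcap_measurable => [|i _].
  exact: finite_finset.
by rewrite -[X in measurable X]setTI; apply: measurable_funPT.
Qed.

Lemma joint_fiber_prob a :
  P (joint @^-1` [set a]) = (#|{ffun I -> F}|%:R^-1)%:E.
Proof.
rewrite joint_fiberE X_indep //.
under eq_bigr do rewrite X_uniform.
rewrite prodEFin; congr (_%:E).
rewrite card_ffun natrX -exprVn -prodr_const.
by apply: eq_bigl => i; rewrite !inE.
Qed.

(** The event is a finite disjoint union of fibres of [joint], all equally likely. *)
Lemma joint_prob (S : {set {ffun I -> F}}) :
  P [set w | joint w \in S] = (#|S|%:R / #|{ffun I -> F}|%:R)%:E.
Proof.
have -> : [set w | joint w \in S] =
    \bigcup_(a in [set` S]) (joint @^-1` [set a]).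
  apply/seteqP; split=> w /=; first by move=> wS; exists (joint w).
  by move=> [a aS /= ->].
rewrite measure_fin_bigcup //; last 2 first.
- by move=> a b _ _ [w [/= <- <-]].
- by move=> a _; apply: measurable_joint_fiber.
rewrite (eq_fsbigr (fun=> (#|{ffun I -> F}|%:R^-1)%:E)) => [|a _]; last first.
  exact: joint_fiber_prob.
rewrite (fsbigE (enum S)) ?enum_uniq //; last 2 first.
- by move=> a /=; rewrite mem_enum.
- by move=> a /= aS; rewrite mem_enum aS.
rewrite big_enum_cond /= sumEFin; congr (_%:E).
rewrite (eq_bigl (mem S)) => [|a]; last by rewrite mem_setE andbb.
by rewrite sumr_const mulr_natl.
Qed.

(* Division-free: the hypothesis says that the complement of [S] has density at
   most [N / #|F|]. *)
Lemma joint_prob_ge (N : nat) (S : {set {ffun I -> F}}) :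
  (#|F| * #|(~: S)%SET| <= N * #|{: {ffun I -> F}}|)%N ->
  ((1 - N%:R / #|F|%:R)%:E <= P [set w | joint w \in S])%E.
Proof.
move=> H; rewrite joint_prob lee_fin.
have F0 : 0 < #|F|%:R :> R by rewrite ltr0n; apply/card_gt0P; exists 0.
have V0 : 0 < #|{ffun I -> F}|%:R :> R.
  by rewrite ltr0n; apply/card_gt0P; exists [ffun=> 0].
have SE : #|S|%:R = #|{ffun I -> F}|%:R - #|(~: S)%SET|%:R :> R.
  by rewrite -(cardsC S) natrD addrK.
rewrite SE mulrBl divff ?gt_eqF // lerD2l lerN2.
by rewrite ler_pdivrMr // mulrAC ler_pdivlMr // mulrC -!natrM ler_nat.
Qed.

End JointLaw.

(** * From counts to the two probability bounds *)

Theorem theorem2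
  (n : nat) (g : rel 'I_n)
  (g_connected : strongly_connected g)
  (g_loops : forall v : 'I_n, g v v)
  (F : finFieldType) (q : nat) (cardF : #|F| = q)
  (d : measure_display) (T : measurableType d) (R : realType)
  (P : probability T R)
  (lambda : edge g -> {RV P >-> discrete F})
  (xi : 'I_n -> {RV P >-> discrete F})
  (lambda_uniform : forall e, uniform_rv (lambda e))
  (xi_uniform : forall i, uniform_rv (xi i))
  (indep : mutually_independent (sum_family lambda xi))
  (A : T -> 'M[F]_n) (x0 : T -> 'cV[F]_n)
  (A_consistent : forall w, consistent g (A w))
  (A_lambda : forall w (e : edge g), A w (val e).2 (val e).1 = lambda e w)
  (x0_xi : forall w i, x0 w i 0 = xi i w) :
  ((n ^ 2 <= q)%N ->
   forall r : 'I_n,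
     ((1 - (n ^ 2)%:R / q%:R)%:E <=
        P [set w | \rank (hankel (A w) (x0 w) r n) = n])%E)
  /\
  (let D : R := (n ^ 3 + n)%:R / 2 in
   D <= q%:R ->
   ((1 - D / q%:R)%:E <=
      P [set w | forall r : 'I_n, \rank (hankel (A w) (x0 w) r n) = n])%E).
Proof.
have X_uniform k : uniform_rv (sum_family lambda xi k) by case: k.
have jointE w : param_mx (joint (sum_family lambda xi) w) = A w /\
    param_cv (joint (sum_family lambda xi) w) = x0 w.
  have -> : joint (sum_family lambda xi) w = param_of g (A w) (x0 w).
    by apply/ffunP => -[e|i]; rewrite !ffunE /= ?A_lambda ?x0_xi.
  exact: param_ofK.
have bin2E : ('C(n, 2) + 'C(n, 2) + n = n ^ 2)%N.
  by rewrite addnn bin2 halfK; case: (n) => // m; rewrite oddM /=; lia.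
(* A singleton [Q] gives the first bound, the full set the second. *)
have main (Q : {set 'I_n}) : (n <= q)%N ->
    ((1 - ('C(n, 2) + n + #|Q| * 'C(n, 2))%:R / q%:R)%:E <=
      P [set w | forall r, r \in Q -> \rank (hankel (A w) (x0 w) r n) = n])%E.
  rewrite -cardF => nF.
  have := card_rank_deficient_le g_loops nF Q g_connected.
  set bad := [set x | _]%SET => bad_le.
  have -> : [set w | forall r, r \in Q -> \rank (hankel (A w) (x0 w) r n) = n] =
      [set w | joint (sum_family lambda xi) w \in (~: bad)%SET].
    apply/seteqP; split=> w /=; rewrite !inE negbK; have [-> ->] := jointE w.
      by move=> H; apply/forall_inP => r rQ; apply/eqP/H.
    by move=> /forall_inP H r rQ; apply/eqP/H.
  by apply: joint_prob_ge => //; rewrite finset.setCK.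
split=> [nq r|D Dq].
  have nq' : (n <= q)%N by nia.
  have := main [set r]%SET nq'; rewrite cards1 mul1n addnAC bin2E.
  congr (_ <= P _)%E; apply/seteqP; split=> w /= H.
    by apply: H; rewrite inE.
  by move=> s; rewrite inE => /eqP ->.
(* [n + (n + 1) n (n - 1) / 2 = (n^3 + n) / 2]. *)
have DE : D = ('C(n, 2) + n + n * 'C(n, 2))%:R.
  rewrite /D; apply: (canLR (mulfK _)); first by rewrite pnatr_eq0.
  by rewrite -natrM; congr (_%:R); nia.
have nq : (n <= q)%N by move: Dq; rewrite DE ler_nat; nia.
have := main [set: 'I_n]%SET nq; rewrite cardsT card_ord -DE.
congr (_ <= P _)%E; apply/seteqP; split=> w /= H r; last by [].
by apply: H; rewrite inE.
Qed.
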